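(* Let $p,q$ be positive integers and let $X_{i|\hat\mu}$, $X^*_{i|\hat\mu}$, $X_{\hat\lambda|\hat\mu}$, $X^*_{i|j}$ be the super minors and fake super minors for $r=s=1$ defined in the context. Then, for all $i,j,k\in\{1,\dots,p\}$ and $\hat\mu,\hat\nu,\hat\lambda\in\{\hat1,\dots,\hat q\}$, the following relations hold in $\tilde{\mathcal O}$: $$X_{i|\hat\mu}X^*_{i|\hat\mu}=1,$$ $$X_{i|\hat\mu}X_{j|\hat\nu}=\mathrm{Ber}\begin{pmatrix} X_{j|\hat\mu} & X_{\hat\nu|\hat\mu} \\ X^*_{i|j} & X^*_{i|\hat\nu} \end{pmatrix},$$ $$X_{i|\hat\mu}X_{\hat\lambda|\hat\nu}=\mathrm{Ber}\begin{pmatrix} X_{\hat\lambda|\hat\mu} & X_{\hat\nu|\hat\mu} \\ X^*_{i|\hat\lambda} & X^*_{i|\hat\nu} \end{pmatrix},$$ $$X^*_{i|\hat\mu}X^*_{j|k}=\mathrm{Ber}^*\begin{pmatrix} X_{j|\hat\mu} & X_{k|\hat\mu} \\ X^*_{i|j} & X^*_{i|k} \end{pmatrix}.$$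
   Context: The ground field is $\mathbf k=\mathbb R$ or $\mathbb C$. $\mathcal O=\mathbf k[x_{1j},x_{\hat1\hat\mu},x_{1\hat\mu},x_{\hat1j}]$ is the free commutative superalgebra (i.e. $ab=(-1)^{p(a)p(b)}ba$ for homogeneous elements) on even generators $x_{1j}$, $x_{\hat1\hat\mu}$ and odd generators $x_{1\hat\mu}$, $x_{\hat1j}$, $1\le j\le p$, $\hat1\le\hat\mu\le\hat q$; these are the coordinates of the supermatrix of size $1|1\times p|q$ whose even columns are $c_j=\begin{pmatrix} x_{1j} \\ x_{\hat1j} \end{pmatrix}$ and whose odd columns are $c_{\hat\mu}=\begin{pmatrix} x_{1\hat\mu} \\ x_{\hat1\hat\mu} \end{pmatrix}$. $\tilde{\mathcal O}$ is the localization of $\mathcal O$ obtained by inverting all $x_{1j}$ and all $x_{\hat1\hat\mu}$. For a $2\times2$ matrix $B=\begin{pmatrix} a & b \\ c & d \end{pmatrix}$ viewed as of size $1|1\times1|1$: $\mathrm{Ber}\,B:=d^{-1}(a-b\,d^{-1}c)$, used when $d$ is even and invertible and $b$ is odd (the first column being either (even; odd), i.e. $B$ is an even supermatrix, or (odd; even), i.e. $B$ is a fake supermatrix of type I); $\mathrm{Ber}^*B:=a^{-1}(d-c\,a^{-1}b)$, used when $a$ is even and invertible and $c$ is odd (the second column being either (odd; even), or (even; odd), i.e. $B$ is a fake supermatrix of type II). The super minors are $X_{i|\hat\mu}:=\mathrm{Ber}(c_i\,|\,c_{\hat\mu})$, $X^*_{i|\hat\mu}:=\mathrm{Ber}^*(c_i\,|\,c_{\hat\mu})$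 (even elements), and the fake super minors are $X_{\hat\lambda|\hat\mu}:=\mathrm{Ber}(c_{\hat\lambda}\,|\,c_{\hat\mu})$, $X^*_{i|j}:=\mathrm{Ber}^*(c_i\,|\,c_j)$ (odd elements), where $(c\,|\,c')$ is the $2\times 2$ matrix with first column $c$ and second column $c'$. *)

(* Defs.v *)
From HB Require Import structures.
From mathcomp Require Import all_boot all_order all_algebra generic_quotient.
From mathcomp Require Import boolp reals complex mpoly ring.

Set Implicit Arguments.
Unset Strict Implicit.
Unset Printing Implicit Defensive.

Import GRing.Theory.
Local Open Scope ring_scope.
Local Open Scope quotient_scope.

Inductive ground := RealGround | ComplexGround.

Definition ground_field (R : realType) (g : ground) : fieldType :=
  match g with
  | RealGround => R : fieldType
  | ComplexGround => R[i] : fieldType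
  end.

(* The exterior algebra A[xi_0, ..., xi_(n-1)] over a commutative ring A: an  *)
(* element f is \sum_S f S * xi_S, where xi_S is the product of the xi_i,     *)
(* i \in S, in increasing order of i. Hence                                   *)
(* xi_S * xi_T = ext_sign S T * xi_(S :|: T), where ext_sign S T is 0 if S    *)
(* and T meet, and otherwise is the sign of the permutation sorting S then T. *)
Section Exterior.
Variables (A : comNzRingType) (n : nat).

Definition exterior : Type := {ffun {set 'I_n} -> A}.

HB.instance Definition _ := GRing.Zmodule.copy exterior {ffun {set 'I_n} -> A}.

Implicit Types (S T U : {set 'I_n}) (f g h : exterior).

Definition inversions S T : nat := (\sum_(i in S) \sum_(j in T) (j < i))%N.

Definition ext_sign S T : A :=
  if [disjoint S & T] then (-1) ^+ inversions S T else 0.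

Definition ext_mul f g : exterior :=
  [ffun V : {set 'I_n} =>
     \sum_S \sum_(T | S :|: T == V) ext_sign S T * (f S * g T)].

Definition extC (a : A) : exterior :=
  [ffun S : {set 'I_n} => if S == set0 then a else 0].

Definition ext_gen (i : 'I_n) : exterior :=
  [ffun S : {set 'I_n} => (S == [set i])%:R].

Lemma ext_signs0 S : ext_sign S set0 = 1.
Proof.
rewrite /ext_sign disjoint_sym disjoints_subset sub0set /inversions big1 //.
by move=> i _; rewrite big_set0.
Qed.

Lemma ext_sign0s S : ext_sign set0 S = 1.
Proof.
by rewrite /ext_sign disjoints_subset sub0set /inversions big_set0.
Qed.

Lemma ext_signC S T :
  ext_sign S T = (-1) ^+ (#|S| * #|T|) * ext_sign T S.
Proof.
rewrite /ext_sign disjoint_sym; case: ifP => [dTS|_]; last by rewrite mulr0.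
suff -> : (#|S| * #|T| = inversions S T + inversions T S)%N.
  by rewrite exprD -mulrA -exprD addnn -mul2n exprM sqrrN !expr1n mulr1.
rewrite /inversions [X in (_ + X)%N]exchange_big -big_split /=.
rewrite -sum_nat_const; apply: eq_bigr => i iS.
rewrite -big_split -sum1_card; apply: eq_bigr => j jT.
have: i != j :> nat.
  apply/eqP=> /val_inj eij; move/pred0P: dTS => /(_ j) /=.
  by rewrite jT -eij iS.
by case: ltngtP.
Qed.

Let sum_setU S T (F : 'I_n -> nat) : [disjoint S & T] ->
  (\sum_(i in S :|: T) F i = \sum_(i in S) F i + \sum_(i in T) F i)%N.
Proof.
by move=> d; rewrite -bigU //; apply: eq_bigl => i; rewrite !inE.
Qed.

Lemma ext_signA S T U :
  ext_sign S T * ext_sign (S :|: T) U = ext_sign T U * ext_sign S (T :|: U).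
Proof.
rewrite /ext_sign !disjoints_subset setCU subUset subsetI -!disjoints_subset.
have [dST|_] := boolP [disjoint S & T]; last by rewrite mul0r /= mulr0.
have [dTU|_] := boolP [disjoint T & U]; last by rewrite andbF mul0r mulr0.
have [dSU|_] := boolP [disjoint S & U]; last by rewrite /= !mulr0.
rewrite /= -!exprD; congr (_ ^+ _).
rewrite /inversions sum_setU //.
have -> : (\sum_(i in S) \sum_(j in T :|: U) (j < i) =
  \sum_(i in S) \sum_(j in T) (j < i) + \sum_(i in S) \sum_(j in U) (j < i))%N.
  by rewrite -big_split; apply: eq_bigr => i _; rewrite sum_setU.
by rewrite addnA addnC addnA.
Qed.

Lemma ext_mulE f g (V : {set 'I_n}) :
  ext_mul f g V =
    \sum_S \sum_T (S :|: T == V)%:R * (ext_sign S T * (f S * g T)).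
Proof.
rewrite ffunE; apply: eq_bigr => S _; rewrite big_mkcond.
by apply: eq_bigr => T _; case: ifP; rewrite ?mul1r ?mul0r.
Qed.

Let pick_sum (I : finType) (i : I) (F : I -> A) :
  \sum_j (i == j)%:R * F j = F i.
Proof.
rewrite (bigD1 i) //= eqxx mul1r big1 ?addr0 // => j /negPf.
by rewrite eq_sym => ->; rewrite mul0r.
Qed.

Let ext_mul3l f g h (V : {set 'I_n}) :
  ext_mul (ext_mul f g) h V = \sum_S \sum_T \sum_U
    (S :|: T :|: U == V)%:R *
      (ext_sign S T * ext_sign (S :|: T) U * (f S * g T * h U)).
Proof.
rewrite ext_mulE exchange_big /=.
under eq_bigr => U _.
  under eq_bigr => W _.
    rewrite ext_mulE mulr_suml !mulr_sumr.
    under eq_bigr => S _.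
      rewrite mulr_suml !mulr_sumr.
      under eq_bigr => T _.
        have -> : (W :|: U == V)%:R *
            (ext_sign W U *
              ((S :|: T == W)%:R * (ext_sign S T * (f S * g T)) * h U)) =
          (S :|: T == W)%:R * ((W :|: U == V)%:R *
            (ext_sign S T * ext_sign W U * (f S * g T * h U))).
          by ring.
        over.
      over.
    over.
  rewrite exchange_big /=.
  under eq_bigr => S _.
    rewrite exchange_big /=.
    under eq_bigr => T _ do rewrite pick_sum.
    over.
  over.
rewrite exchange_big; apply: eq_bigr => S _.
by rewrite exchange_big.
Qed.

Let ext_mul3r f g h (V : {set 'I_n}) :
  ext_mul f (ext_mul g h) V = \sum_S \sum_T \sum_U
    (S :|: (T :|: U) == V)%:R *
      (ext_sign T U * ext_sign S (T :|: U) * (f S * g T * h U)).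
Proof.
rewrite ext_mulE; apply: eq_bigr => S _.
under eq_bigr => W _.
  rewrite ext_mulE mulr_sumr !mulr_sumr.
  under eq_bigr => T _.
    rewrite !mulr_sumr.
    under eq_bigr => U _.
      have -> : (S :|: W == V)%:R *
          (ext_sign S W *
            (f S * ((T :|: U == W)%:R * (ext_sign T U * (g T * h U))))) =
        (T :|: U == W)%:R * ((S :|: W == V)%:R *
          (ext_sign T U * ext_sign S W * (f S * g T * h U))).
        by ring.
      over.
    over.
  over.
rewrite exchange_big /=; apply: eq_bigr => T _.
rewrite exchange_big /=; apply: eq_bigr => U _.
by rewrite pick_sum.
Qed.

Lemma ext_mulA : associative ext_mul.
Proof.
move=> f g h; apply/ffunP => V; rewrite ext_mul3l ext_mul3r.
apply: eq_bigr => S _; apply: eq_bigr => T _; apply: eq_bigr => U _.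
by rewrite ext_signA setUA.
Qed.

Lemma ext_mulC1 a f (V : {set 'I_n}) : ext_mul (extC a) f V = a * f V.
Proof.
rewrite ext_mulE (bigD1 set0) //= [X in _ + X]big1 ?addr0 => [|S /negPf S0].
  under eq_bigr => T _ do rewrite set0U eq_sym.
  by rewrite pick_sum ext_sign0s mul1r ffunE eqxx.
by rewrite big1 // => T _; rewrite ffunE S0 mul0r !mulr0.
Qed.

Lemma ext_mul1C a f (V : {set 'I_n}) : ext_mul f (extC a) V = f V * a.
Proof.
rewrite ext_mulE exchange_big (bigD1 set0) //=.
rewrite [X in _ + X]big1 ?addr0 => [|S /negPf S0].
  under eq_bigr => T _ do rewrite setU0 eq_sym.
  by rewrite pick_sum ext_signs0 mul1r ffunE eqxx.
by rewrite big1 // => T _; rewrite ffunE S0 !mulr0.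
Qed.

Lemma ext_mul1r : left_id (extC 1) ext_mul.
Proof. by move=> f; apply/ffunP => V; rewrite ext_mulC1 mul1r. Qed.

Lemma ext_mulr1 : right_id (extC 1) ext_mul.
Proof. by move=> f; apply/ffunP => V; rewrite ext_mul1C mulr1. Qed.

Lemma ext_mulDl : left_distributive ext_mul +%R.
Proof.
move=> f g h; apply/ffunP => V; rewrite [RHS]ffunE !ext_mulE -big_split.
apply: eq_bigr => S _; rewrite -big_split; apply: eq_bigr => T _ /=.
by rewrite ffunE mulrDl !mulrDr.
Qed.

Lemma ext_mulDr : right_distributive ext_mul +%R.
Proof.
move=> f g h; apply/ffunP => V; rewrite [RHS]ffunE !ext_mulE -big_split.
apply: eq_bigr => S _; rewrite -big_split; apply: eq_bigr => T _ /=.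
by rewrite ffunE !mulrDr.
Qed.

Lemma ext_1neq0 : extC 1 != 0.
Proof.
by apply/eqP => /ffunP /(_ set0); rewrite !ffunE eqxx => /eqP; rewrite oner_eq0.
Qed.

HB.instance Definition _ := GRing.Zmodule_isNzRing.Build exterior
  ext_mulA ext_mul1r ext_mulr1 ext_mulDl ext_mulDr ext_1neq0.

Lemma extC_inj : injective extC.
Proof. by move=> a b /ffunP /(_ set0); rewrite !ffunE eqxx. Qed.

Lemma extC_is_zmod_morphism : zmod_morphism extC.
Proof.
move=> a b; apply/ffunP => S; rewrite !ffunE.
by case: ifP; rewrite ?subr0.
Qed.

Lemma extC_is_monoid_morphism : monoid_morphism extC.
Proof.
split=> // a b; apply/ffunP => S; rewrite [RHS]ext_mulC1 !ffunE.
by case: ifP; rewrite ?mulr0.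
Qed.

HB.instance Definition _ :=
  GRing.isZmodMorphism.Build A exterior extC extC_is_zmod_morphism.
HB.instance Definition _ :=
  GRing.isMonoidMorphism.Build A exterior extC extC_is_monoid_morphism.

Lemma extC_central a f : extC a * f = f * extC a.
Proof. by apply/ffunP => S; rewrite [LHS]ext_mulC1 [RHS]ext_mul1C mulrC. Qed.

(* homogeneous of parity b, true meaning odd *)
Definition ext_homog (b : bool) f := forall S, odd #|S| != b -> f S = 0.

Lemma extC_homog a : ext_homog false (extC a).
Proof. by move=> S; rewrite ffunE; case: (S =P set0) => // ->; rewrite cards0. Qed.

Lemma ext_gen_homog i : ext_homog true (ext_gen i).
Proof. by move=> S; rewrite ffunE; case: (S =P _) => // ->; rewrite cards1. Qed.

Lemma ext_supercomm (b c : bool) f g : ext_homog b f -> ext_homog c g ->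
  f * g = (-1) ^+ (b * c)%N * (g * f).
Proof.
move=> hf hg.
have -> : (-1) ^+ (b * c)%N = extC ((-1) ^+ (b * c)%N).
  by rewrite rmorphXn rmorphN rmorph1.
apply/ffunP => V; rewrite [RHS]ext_mulC1 [LHS]ext_mulE [X in _ * X]ext_mulE.
rewrite exchange_big mulr_sumr; apply: eq_bigr => T _.
rewrite mulr_sumr; apply: eq_bigr => S _.
rewrite setUC [RHS]mulrCA; congr (_ * _).
have [oS|/hf ->] := eqVneq (odd #|S|) b; last by rewrite !(mul0r, mulr0).
have [oT|/hg ->] := eqVneq (odd #|T|) c; last by rewrite !(mul0r, mulr0).
rewrite ext_signC (mulrC (f S)) -!mulrA; congr (_ * _).
by rewrite -[LHS]signr_odd oddM oS oT -[RHS]signr_odd oddM !oddb.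
Qed.

Definition ext_basis S : exterior := [ffun T : {set 'I_n} => (T == S)%:R].

Lemma ext_basisM S T :
  ext_basis S * ext_basis T = extC (ext_sign S T) * ext_basis (S :|: T).
Proof.
apply/ffunP => V; rewrite [RHS]ext_mulC1 [LHS]ext_mulE !ffunE.
transitivity (\sum_S' (S == S')%:R * \sum_T' (T == T')%:R *
    (ext_sign S' T' * (V == S' :|: T')%:R)).
  apply: eq_bigr => S' _; rewrite mulr_sumr; apply: eq_bigr => T' _.
  rewrite !ffunE (eq_sym S) (eq_sym T) (eq_sym V); ring.
by rewrite !pick_sum.
Qed.

Lemma ext_basisE S : ext_basis S = \prod_(i <- enum S) ext_gen i.
Proof.
have : sorted (fun i j : 'I_n => i < j)%N (enum S).
  rewrite /enum_mem -enumT; apply: sorted_filter.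
    by move=> ? ? ?; apply: ltn_trans.
  by have := iota_ltn_sorted 0 n; rewrite -val_enum_ord sorted_map enumT.
rewrite -[S in ext_basis S]set_enum; elim: (enum S) => [_|i s IHs s_sorted].
  rewrite big_nil; apply/ffunP => T; rewrite !ffunE.
  have -> : [set i in [::]] = set0 :> {set 'I_n}.
    by apply/setP => i; rewrite !inE.
  by case: eqP.
have lt_i : all (fun j : 'I_n => i < j)%N s.
  by apply: order_path_min s_sorted => ? ? ?; apply: ltn_trans.
rewrite big_cons -IHs ?(path_sorted s_sorted) //.
rewrite [RHS](ext_basisM [set i] [set j in s]) set_cons.
suff -> : ext_sign [set i] [set j in s] = 1 by rewrite rmorph1 mul1r.
rewrite /ext_sign disjoints1 inE.
have -> : i \notin s by apply/negP => /(allP lt_i); rewrite ltnn.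
rewrite /inversions big_set1 big1 // => j; rewrite inE => /(allP lt_i).
by case: ltngtP.
Qed.

Lemma ext_decomp f : f = \sum_S extC (f S) * \prod_(i <- enum S) ext_gen i.
Proof.
apply/ffunP => V; rewrite sum_ffunE; under eq_bigr => S _.
  rewrite -ext_basisE [(_ * _ : exterior) V]ext_mulC1 ffunE mulrC.
  over.
by rewrite pick_sum.
Qed.

End Exterior.

(* A multiplicative set of central elements; ruling out 0 keeps the           *)
(* localization a nonzero ring.                                               *)
Record mulset (R : nzRingType) := Mulset {
  mulset_pred :> {pred R};
  mulset1 : 1 \in mulset_pred;
  mulsetM : forall s t,
    s \in mulset_pred -> t \in mulset_pred -> s * t \in mulset_pred;
  mulsetC : forall s a, s \in mulset_pred -> s * a = a * s;
  mulset0 : 0 \notin mulset_pred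
}.

Section Localization.
Variables (R : nzRingType) (S : mulset R).

Definition fracs : Type := {nd : R * R | nd.2 \in S}.
HB.instance Definition _ := Choice.on fracs.

Implicit Types (x y z : fracs).

Definition fnum x := (val x).1.
Definition fden x := (val x).2.

Definition mkfrac a s (hs : s \in S) : fracs := exist _ (a, s) hs.

Definition frac_eq : rel fracs := fun x y =>
  `[< exists2 u, u \in S & u * (fnum x * fden y) = u * (fnum y * fden x) >].

Lemma fnum_mk a s (hs : s \in S) : fnum (mkfrac a hs) = a. Proof. by []. Qed.
Lemma fden_mk a s (hs : s \in S) : fden (mkfrac a hs) = s. Proof. by []. Qed.

Lemma fdenP x : fden x \in S. Proof. exact: (valP x). Qed.

Let SC s t : s \in S -> forall a, a * (s * t) = a * (t * s).
Proof. by move=> hs a; rewrite (mulsetC t hs). Qed.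

Let CA s a b : s \in S -> s * (a * b) = a * (s * b).
Proof. by move=> hs; rewrite !mulrA (mulsetC a hs). Qed.

Lemma frac_eq_refl : reflexive frac_eq.
Proof. by move=> x; apply/asboolP; exists 1 => //; apply: mulset1. Qed.

Lemma frac_eq_sym : ssrbool.symmetric frac_eq.
Proof.
by move=> x y; apply/asboolP/asboolP => -[u hu e]; exists u => //; rewrite e.
Qed.

Lemma frac_eq_trans : transitive frac_eq.
Proof.
move=> y x z /asboolP [u hu e] /asboolP [v hv e']; apply/asboolP.
exists (u * v * fden y); first by rewrite !mulsetM // fdenP.
have hx := fdenP x; have hy := fdenP y; have hz := fdenP z.
rewrite -!mulrA.
transitivity (v * ((u * (fnum x * fden y)) * fden z)).
  rewrite (CA _ _ hu) -!mulrA; congr (_ * _); congr (_ * _).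
  by rewrite (CA _ _ hy).
rewrite e; transitivity (u * ((v * (fnum y * fden z)) * fden x)).
  rewrite -!mulrA (CA _ _ hv); congr (_ * (_ * (_ * _))).
  by rewrite (mulsetC _ hx).
rewrite e' -!mulrA; congr (_ * (_ * _)).
by rewrite (CA _ _ hy).
Qed.

Canonical frac_eq_equiv :=
  EquivRel frac_eq frac_eq_refl frac_eq_sym frac_eq_trans.

Definition localization : Type := {eq_quot frac_eq}.
HB.instance Definition _ : EqQuotient _ frac_eq localization :=
  EqQuotient.on localization.
HB.instance Definition _ := Choice.on localization.

Local Notation piL := (\pi_localization).

Lemma piL_eq x y : frac_eq x y -> piL x = piL y.
Proof. by move=> e; apply/eqmodP. Qed.

Lemma piL_repr x : frac_eq (repr (piL x)) x.
Proof.
have: repr (piL x) = x %[mod localization] by rewrite reprK.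
by move/eqmodP.
Qed.

Definition fracC a : fracs := mkfrac a (mulset1 S).
Definition frac_add x y : fracs :=
  mkfrac (fnum x * fden y + fnum y * fden x) (mulsetM (fdenP x) (fdenP y)).
Definition frac_opp x : fracs := mkfrac (- fnum x) (fdenP x).
Definition frac_mul x y : fracs :=
  mkfrac (fnum x * fnum y) (mulsetM (fdenP x) (fdenP y)).

Definition loc_embed a : localization := piL (fracC a).
Definition loc_add (a b : localization) : localization :=
  piL (frac_add (repr a) (repr b)).
Definition loc_opp (a : localization) : localization := piL (frac_opp (repr a)).
Definition loc_mul (a b : localization) : localization :=
  piL (frac_mul (repr a) (repr b)).

Let fnum_C a : fnum (fracC a) = a. Proof. by []. Qed.
Let fden_C a : fden (fracC a) = 1. Proof. by []. Qed.
Let fnum_add x y : fnum (frac_add x y) = fnum x * fden y + fnum y * fden x.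
Proof. by []. Qed.
Let fden_add x y : fden (frac_add x y) = fden x * fden y. Proof. by []. Qed.
Let fnum_opp x : fnum (frac_opp x) = - fnum x. Proof. by []. Qed.
Let fden_opp x : fden (frac_opp x) = fden x. Proof. by []. Qed.
Let fnum_mul x y : fnum (frac_mul x y) = fnum x * fnum y. Proof. by []. Qed.
Let fden_mul x y : fden (frac_mul x y) = fden x * fden y. Proof. by []. Qed.
Let fracE := (fnum_C, fden_C, fnum_add, fden_add, fnum_opp, fden_opp,
  fnum_mul, fden_mul, fnum_mk, fden_mk).

Let frac_eqI x y : fnum x = fnum y -> fden x = fden y -> x = y.
Proof.
case: x y => [[a s] hs] [[b t] ht]; rewrite !fracE => ea es.
by apply: val_inj; rewrite /= ea es.
Qed.

Let frac_addC x y : frac_add x y = frac_add y x.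
Proof.
apply: frac_eqI; rewrite fracE; first by rewrite addrC.
by rewrite (mulsetC _ (fdenP x)).
Qed.

Let frac_add_congr x x' y : frac_eq x x' -> frac_eq (frac_add x y) (frac_add x' y).
Proof.
move=> /asboolP [u hu e]; apply/asboolP; exists u => //.
have hx := fdenP x; have hy := fdenP y; have hx' := fdenP x'.
rewrite !fracE.
rewrite !mulrDl !mulrDr; congr (_ + _); last first.
  congr (_ * _); rewrite -!mulrA; congr (_ * _).
  by rewrite !mulrA (mulsetC _ hx).
rewrite -!mulrA !(CA _ _ hy).
have E a s : u * (a * (s * (fden y * fden y))) =
   u * (a * s) * (fden y * fden y) by rewrite -!mulrA.
by rewrite !E e.
Qed.

Let frac_mul_congr x x' y y' : frac_eq x x' -> frac_eq y y' ->
  frac_eq (frac_mul x y) (frac_mul x' y').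
Proof.
move=> /asboolP [u hu e] /asboolP [v hv e']; apply/asboolP.
exists (u * v); first exact: mulsetM.
have E a b s t : s \in S -> u * v * (a * b * (s * t)) =
    u * (a * s) * (v * (b * t)).
  by move=> hs; rewrite -!mulrA !(CA _ _ hv) (CA b _ hs).
rewrite !fracE.
by rewrite !E ?fdenP // e e'.
Qed.

Let loc_addE x y : loc_add (piL x) (piL y) = piL (frac_add x y).
Proof.
apply: piL_eq; apply: (frac_eq_trans (y := frac_add x (repr (piL y)))).
  exact/frac_add_congr/piL_repr.
by rewrite !(frac_addC x); apply/frac_add_congr/piL_repr.
Qed.

Let loc_oppE x : loc_opp (piL x) = piL (frac_opp x).
Proof.
apply: piL_eq; have /asboolP [u hu e] := piL_repr x.
apply/asboolP; exists u => //.
by rewrite !fracE !mulNr !mulrN; congr (- _).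
Qed.

Let loc_mulE x y : loc_mul (piL x) (piL y) = piL (frac_mul x y).
Proof. by apply: piL_eq; apply: frac_mul_congr; apply: piL_repr. Qed.

Lemma loc_addA : associative loc_add.
Proof.
elim/quotW=> x; elim/quotW=> y; elim/quotW=> z.
rewrite (loc_addE y z) (loc_addE x y) !loc_addE; congr (piL _).
have hx := fdenP x; have hy := fdenP y; have hz := fdenP z.
apply: frac_eqI; rewrite !fracE ?mulrA //.
rewrite !mulrDl -!addrA -!mulrA; congr (_ + (_ + _)).
  by rewrite (mulsetC _ hz).
by rewrite (mulsetC _ hx).
Qed.

Lemma loc_addC : commutative loc_add.
Proof.
by elim/quotW=> x; elim/quotW=> y; rewrite !loc_addE frac_addC.
Qed.

Lemma loc_add0 : left_id (loc_embed 0) loc_add.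
Proof.
elim/quotW=> x; rewrite loc_addE; congr (piL _).
by apply: frac_eqI; rewrite !fracE ?mul1r // mul0r add0r mulr1.
Qed.

Lemma loc_addN : left_inverse (loc_embed 0) loc_opp loc_add.
Proof.
elim/quotW=> x; rewrite loc_oppE loc_addE; apply: piL_eq; apply/asboolP.
exists 1; first exact: mulset1.
by rewrite !fracE mulNr addNr !mul0r.
Qed.

HB.instance Definition _ := GRing.isZmodule.Build localization
  loc_addA loc_addC loc_add0 loc_addN.

Lemma loc_mulA : associative loc_mul.
Proof.
elim/quotW=> x; elim/quotW=> y; elim/quotW=> z.
by rewrite (loc_mulE y z) (loc_mulE x y) !loc_mulE; congr (piL _);
  apply: frac_eqI; rewrite !fracE mulrA.
Qed.

Lemma loc_mul1 : left_id (loc_embed 1) loc_mul.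
Proof.
elim/quotW=> x; rewrite loc_mulE; congr (piL _).
by apply: frac_eqI; rewrite !fracE mul1r.
Qed.

Lemma loc_mulr1 : right_id (loc_embed 1) loc_mul.
Proof.
elim/quotW=> x; rewrite loc_mulE; congr (piL _).
by apply: frac_eqI; rewrite !fracE mulr1.
Qed.

Lemma loc_mulDl : left_distributive loc_mul loc_add.
Proof.
elim/quotW=> x; elim/quotW=> y; elim/quotW=> z.
rewrite (loc_addE x y) (loc_mulE x z) (loc_mulE y z) loc_addE loc_mulE.
apply: piL_eq; apply/asboolP.
have hx := fdenP x; have hy := fdenP y; have hz := fdenP z.
exists 1; first exact: mulset1.
rewrite !fracE !mul1r !mulrDl -!mulrA.
by congr (_ + _); rewrite ?(CA (fnum z) _ hy) ?(CA (fnum z) _ hx);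
  rewrite !(CA (fden x) _ hz) ?(CA (fden x) _ hy).
Qed.

Lemma loc_mulDr : right_distributive loc_mul loc_add.
Proof.
elim/quotW=> x; elim/quotW=> y; elim/quotW=> z.
rewrite (loc_addE y z) (loc_mulE x y) (loc_mulE x z) loc_addE loc_mulE.
apply: piL_eq; apply/asboolP.
have hx := fdenP x; have hy := fdenP y; have hz := fdenP z.
exists 1; first exact: mulset1.
rewrite !fracE !mul1r !mulrDr !mulrDl -!mulrA.
by congr (_ + _); rewrite !(CA (fden x) _ hy) ?(CA (fden x) _ hz).
Qed.

Lemma loc_embed_eq0 a : loc_embed a = 0 -> exists2 u, u \in S & u * a = 0.
Proof.
move=> /eqmodP /asboolP [u hu].
by rewrite !fracE mulr1 mul0r mulr0 => e; exists u.
Qed.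

Lemma loc_1neq0 : loc_embed 1 != 0.
Proof.
apply/eqP => /loc_embed_eq0 [u hu]; rewrite mulr1 => u0.
by have := mulset0 S; rewrite -u0 hu.
Qed.

HB.instance Definition _ := GRing.Zmodule_isNzRing.Build localization
  loc_mulA loc_mul1 loc_mulr1 loc_mulDl loc_mulDr loc_1neq0.

(* The inverse is the true one on invertible elements, and the identity       *)
(* elsewhere, as in every unitRingType.                                       *)
Definition loc_unit : {pred localization} :=
  fun a => `[< exists b, b * a = 1 /\ a * b = 1 >].

Definition loc_inv (a : localization) : localization :=
  match pselect (exists b, b * a = 1 /\ a * b = 1) with
  | left h => projT1 (cid h)
  | right _ => a
  end.

Lemma loc_mulVr : {in loc_unit, left_inverse 1 loc_inv *%R}.
Proof.
move=> a /asboolP ha; rewrite /loc_inv; case: pselect => // h.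
by case: cid => b [].
Qed.

Lemma loc_divrr : {in loc_unit, right_inverse 1 loc_inv *%R}.
Proof.
move=> a /asboolP ha; rewrite /loc_inv; case: pselect => // h.
by case: cid => b [].
Qed.

Lemma loc_unitP a b : b * a = 1 /\ a * b = 1 -> a \in loc_unit.
Proof. by move=> h; apply/asboolP; exists b. Qed.

Lemma loc_inv_out : {in [predC loc_unit], loc_inv =1 id}.
Proof.
move=> a; rewrite inE => /asboolP na; rewrite /loc_inv.
by case: pselect => // h; case: na.
Qed.

HB.instance Definition _ := GRing.NzRing_hasMulInverse.Build localization
  loc_mulVr loc_divrr loc_unitP loc_inv_out.

Let locDE a b : a + b = loc_add a b. Proof. by []. Qed.
Let locNE a : - a = loc_opp a. Proof. by []. Qed.
Let locME (a b : localization) : a * b = loc_mul a b. Proof. by []. Qed.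

Lemma loc_embed_is_zmod_morphism : zmod_morphism loc_embed.
Proof.
move=> a b; rewrite locNE loc_oppE locDE loc_addE; congr (piL _).
by apply: frac_eqI; rewrite !fracE ?mulr1.
Qed.

Lemma loc_embed_is_monoid_morphism : monoid_morphism loc_embed.
Proof.
split=> // a b; rewrite locME loc_mulE; congr (piL _).
by apply: frac_eqI; rewrite !fracE ?mulr1.
Qed.

HB.instance Definition _ :=
  GRing.isZmodMorphism.Build R localization loc_embed loc_embed_is_zmod_morphism.
HB.instance Definition _ :=
  GRing.isMonoidMorphism.Build R localization loc_embed
    loc_embed_is_monoid_morphism.

Lemma loc_embed_unit s : s \in S -> loc_embed s \is a GRing.unit.
Proof.
move=> hs; apply: (@loc_unitP _ (piL (mkfrac 1 hs))).
split; rewrite locME loc_mulE; apply: piL_eq; apply/asboolP;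
  exists 1; rewrite ?mulset1 //.
  by rewrite !fracE !mulr1 !mul1r.
by rewrite !fracE !mulr1 !mul1r.
Qed.

End Localization.

Definition Ber (A : unitRingType) (B : 'M[A]_(1 + 1)) : A :=
  let a := ulsubmx B 0 0 in let b := ursubmx B 0 0 in
  let c := dlsubmx B 0 0 in let d := drsubmx B 0 0 in
  d^-1 * (a - b * d^-1 * c).

Definition Ber_star (A : unitRingType) (B : 'M[A]_(1 + 1)) : A :=
  let a := ulsubmx B 0 0 in let b := ursubmx B 0 0 in
  let c := dlsubmx B 0 0 in let d := drsubmx B 0 0 in
  a^-1 * (d - c * a^-1 * b).

Definition mx22 (A : Type) (a b c d : A) : 'M[A]_(1 + 1) :=
  block_mx (const_mx a) (const_mx b) (const_mx c) (const_mx d).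

Section SuperMinors.
Variables (k : fieldType) (p q : nat).

(* Even generators: x_{1j} has index lshift q j, x_{^1^mu} has index          *)
(* rshift p mu. Odd generators: x_{^1j} has index lshift q j, x_{1^mu} has    *)
(* index rshift p mu.                                                         *)
Definition superO : nzRingType := exterior {mpoly k[p + q]} (p + q).

Definition even_gen (i : 'I_(p + q)) : superO := extC (p + q) 'X_i.
Definition odd_gen (i : 'I_(p + q)) : superO := ext_gen _ i.

Definition even_monomials : {pred superO} :=
  fun a => `[< exists m : 'X_{1..p + q},
                 a = \prod_(i < p + q) even_gen i ^+ m i >].

Lemma even_monomialE (m : 'X_{1..p + q}) :
  \prod_(i < p + q) even_gen i ^+ m i = extC (p + q) 'X_[m].
Proof.
rewrite mpolyXE_id rmorph_prod; apply: eq_bigr => i _.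
by rewrite rmorphXn.
Qed.

Fact even_monomials1 : 1 \in even_monomials.
Proof.
by apply/asboolP; exists 0%MM; rewrite even_monomialE mpolyX0 rmorph1.
Qed.

Fact even_monomialsM s t :
  s \in even_monomials -> t \in even_monomials -> s * t \in even_monomials.
Proof.
move=> /asboolP [m ->] /asboolP [m' ->]; apply/asboolP.
by exists (m + m')%MM; rewrite !even_monomialE mpolyXD rmorphM.
Qed.

Fact even_monomialsC s a : s \in even_monomials -> s * a = a * s.
Proof. by move=> /asboolP [m ->]; rewrite even_monomialE extC_central. Qed.

Fact even_monomials0 : 0 \notin even_monomials.
Proof.
apply/asboolP => -[m]; rewrite even_monomialE -(rmorph0 (@extC _ _)).
by move/extC_inj/mpolyP/(_ m)/eqP; rewrite mcoeff0 mcoeffX eqxx eq_sym oner_eq0.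
Qed.

Definition even_mulset : mulset superO :=
  Mulset even_monomials1 even_monomialsM even_monomialsC even_monomials0.

Definition superOt : unitRingType := localization even_mulset.

Definition x_ev (i : 'I_(p + q)) : superOt := loc_embed even_mulset (even_gen i).
Definition x_od (i : 'I_(p + q)) : superOt := loc_embed even_mulset (odd_gen i).

Lemma x_ev_unit i : x_ev i \is a GRing.unit.
Proof.
apply: loc_embed_unit; apply/asboolP; exists U_(i)%MM.
by rewrite even_monomialE.
Qed.

Definition coord_mx : 'M[superOt]_(1 + 1, p + q) :=
  block_mx (\row_j x_ev (lshift q j)) (\row_mu x_od (rshift p mu))
           (\row_j x_od (lshift q j)) (\row_mu x_ev (rshift p mu)).

Definition even_col (j : 'I_p) : 'cV[superOt]_(1 + 1) := col (lshift q j) coord_mx.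
Definition odd_col (mu : 'I_q) : 'cV[superOt]_(1 + 1) := col (rshift p mu) coord_mx.

Definition sminor (i : 'I_p) (mu : 'I_q) : superOt :=
  Ber (row_mx (even_col i) (odd_col mu)).
Definition sminor_star (i : 'I_p) (mu : 'I_q) : superOt :=
  Ber_star (row_mx (even_col i) (odd_col mu)).
Definition fminor (lam mu : 'I_q) : superOt :=
  Ber (row_mx (odd_col lam) (odd_col mu)).
Definition fminor_star (i j : 'I_p) : superOt :=
  Ber_star (row_mx (even_col i) (even_col j)).

End SuperMinors.

(* Main.v *)
(** The matrices (c_i | c_mu), (c_lam | c_mu), (c_i | c_j) differ only by parity
swaps of their columns. Call, for each column c, [ev c] its even entry, [od c]
its odd entry and t = od c / ev c; then every minor and fake minor is one of
  ber_even c c' = (1 - t' t) (ev c / ev c'),  ber_odd c c' = (t - t') (ev c / ev c').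
The ratios ev c / ev c' are central and telescope, so they factor out of each
relation, which becomes a polynomial identity between anticommuting elements of
square zero. The last relation is the third one with the parities exchanged. *)
Require Import Defs.
From mathcomp Require Import all_boot all_order all_algebra reals.
From mathcomp Require Import boolp.

Set Implicit Arguments.
Unset Strict Implicit.
Unset Printing Implicit Defensive.

Import GRing.Theory.
Local Open Scope ring_scope.

Lemma BerE (A : unitRingType) (B : 'M[A]_(1 + 1)) :
  Ber B = (B (rshift 1 0) (rshift 1 0))^-1 *
    (B (lshift 1 0) (lshift 1 0) -
     B (lshift 1 0) (rshift 1 0) * (B (rshift 1 0) (rshift 1 0))^-1 *
     B (rshift 1 0) (lshift 1 0)).
Proof. by rewrite /Ber !mxE. Qed.

Lemma Ber_starE (A : unitRingType) (B : 'M[A]_(1 + 1)) :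
  Ber_star B = (B (lshift 1 0) (lshift 1 0))^-1 *
    (B (rshift 1 0) (rshift 1 0) -
     B (rshift 1 0) (lshift 1 0) * (B (lshift 1 0) (lshift 1 0))^-1 *
     B (lshift 1 0) (rshift 1 0)).
Proof. by rewrite /Ber_star !mxE. Qed.

Lemma Ber_mx22 (A : unitRingType) (a b c d : A) :
  Ber (mx22 a b c d) = d^-1 * (a - b * d^-1 * c).
Proof.
by rewrite BerE /mx22 !(block_mxEul, block_mxEur, block_mxEdl, block_mxEdr) !mxE.
Qed.

Lemma Ber_star_mx22 (A : unitRingType) (a b c d : A) :
  Ber_star (mx22 a b c d) = a^-1 * (d - c * a^-1 * b).
Proof.
by rewrite Ber_starE /mx22 !(block_mxEul, block_mxEur, block_mxEdl, block_mxEdr)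
  !mxE.
Qed.

(** The factors are [1 - x] and [1 + x] with [x = n * e], and [x * x] vanishes because moving [e]
    past [n] exposes [n * n]. *)
Lemma odd_identity_inv (A : nzRingType) (n e : A) :
  e * n = - (n * e) -> n * n = 0 -> (1 - n * e) * (1 - e * n) = 1.
Proof.
move=> en nn; rewrite en opprK mulrBl mul1r mulrDr mulr1.
rewrite (mulrA (n * e)) -(mulrA n e) en mulrN mulrA nn mul0r oppr0 mul0r.
by rewrite addr0 addrK.
Qed.

Section OddIdentities.
Variables (A : nzRingType) (m n e : A).
Hypotheses (nm : n * m = - (m * n)) (em : e * m = - (m * e)).
Hypotheses (en : e * n = - (n * e)) (nn : n * n = 0) (ee : e * e = 0).

(** In a left-associated word two adjacent letters after a prefix [t] do not form a subterm; this
    variant lets a rule for [x * y] act there. *)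
Let mulrA_sub (x y z : A) : x * y = z -> forall t, t * x * y = t * z.
Proof. by move=> <- t; rewrite mulrA. Qed.

Let expandE := (@mulrDl A, @mulrDr A, @mulrN A, @mulNr A, @opprK A, @opprD A,
  @mul1r A, @mulr1 A, @mulrA A,
  (@mulr0 A, @mul0r A, @oppr0 A, @addr0 A, @add0r A)).
(** Sorts words into the order [m], [n], [e], killing those in which [n] or [e] meets itself. *)
Let sortE := (nm, em, en, nn, ee,
  (mulrA_sub nm, mulrA_sub em, mulrA_sub en, mulrA_sub nn, mulrA_sub ee)).

(** What remains of the second relation once the even ratios are removed: [m], [n], [e], [f] are the
    odd ratios of four columns. Both factors [1 - n * e] come from inverting the lower right
    entry. *)
Lemma odd_identity_even (f : A) : f * e = - (e * f) ->
  (1 - m * e) * (1 - n * f) =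
  (1 - n * e) * ((1 - m * f) - (n - m) * (1 - n * e) * (f - e)).
Proof.
move=> fe; rewrite !(expandE, sortE, fe, mulrA_sub fe).
(* Of the ten surviving monomials, the first four listed make up the left side and each bracketed
   pair cancels. *)
rewrite !addrA [RHS](ACl (1*3*7*10*(2*4)*(5*9)*(6*8)))%AC /=.
by rewrite !addNr subrr !addr0.
Qed.

Lemma odd_identity_odd (l : A) : l * e = - (e * l) ->
  (1 - m * e) * (l - n) =
  (1 - n * e) * ((l - m) - (n - m) * (1 - n * e) * (1 - e * l)).
Proof.
move=> le; rewrite !(expandE, sortE, le, mulrA_sub le).
rewrite !addrA [RHS](ACl (1*3*7*10*(2*4)*(5*9)*(6*8)))%AC /=.
by rewrite !addNr subrr !addr0.
Qed.

End OddIdentities.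

Section SuperColumns.
Variables (A : unitRingType) (I : Type) (ev od : I -> A).
Hypotheses (ev_unit : forall i, ev i \is a GRing.unit)
  (evC : forall i a, ev i * a = a * ev i)
  (odC : forall i j, od i * od j = - (od j * od i))
  (od_sq : forall i, od i * od i = 0).
Implicit Types (i j m n l : I).

Definition ber_even i j := (ev j)^-1 * (ev i - od j * (ev j)^-1 * od i).
Definition ber_odd i j := (ev j)^-1 * (od i - od j * (ev j)^-1 * ev i).

Let t i := od i / ev i.
Let s i j := ev i / ev j.

Let evVC i a : (ev i)^-1 * a = a * (ev i)^-1.
Proof. by apply/esym/commrV => /=; rewrite /GRing.comm evC. Qed.

Let sC i j a : s i j * a = a * s i j.
Proof. by rewrite /s -mulrA evVC !mulrA evC. Qed.

Let s_chain i j l : s i j * s j l = s i l.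
Proof. by rewrite /s mulrA divrK. Qed.

Let ttE i j : t i * t j = od i * od j * ((ev i)^-1 * (ev j)^-1).
Proof. by rewrite /t -!mulrA; congr (_ * _); rewrite mulrA evVC -mulrA. Qed.

Let tC i j : t i * t j = - (t j * t i).
Proof. by rewrite !ttE odC mulNr evVC. Qed.

Let t_sq i : t i * t i = 0.
Proof. by rewrite ttE od_sq mul0r. Qed.

Let mul_s x y i j l r : (x * s i j) * (y * s l r) = x * y * (s i j * s l r).
Proof. by rewrite -(mulrA x) (mulrA (s i j)) sC -(mulrA y) (mulrA x). Qed.

Lemma ber_evenE i j : ber_even i j = (1 - t j * t i) * s i j.
Proof.
rewrite /ber_even evVC /s [RHS]mulrA [in RHS]mulrBl mul1r; congr ((_ - _) * _).
by rewrite /t -!mulrA mulVr // mulr1.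
Qed.

Lemma ber_oddE i j : ber_odd i j = (t i - t j) * s i j.
Proof.
rewrite /ber_odd evVC /s [RHS]mulrA [in RHS]mulrBl; congr ((_ - _) * _).
by rewrite /t divrK.
Qed.

Lemma ber_evenM i j : ber_even i j * ber_even j i = 1.
Proof.
by rewrite !ber_evenE mul_s s_chain /s divrr // mulr1 odd_identity_inv.
Qed.

Lemma ber_evenV i j : (ber_even i j)^-1 = ber_even j i.
Proof.
(* Off the units [^-1] is the identity by convention, so invertibility has to come before
   cancellation. *)
have u : ber_even i j \is a GRing.unit.
  by apply/unitrP; exists (ber_even j i); rewrite !ber_evenM.
by apply: (mulrI u); rewrite divrr // ber_evenM.
Qed.

(** The three ratios in the subtracted product telescope to [s l m], the ratio already carried by
    [y]. It therefore leaves the bracket, and [s i n * s l m] regroups through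
    [s i n = s i m * s m n]. *)
Let factor_s x y z w i m l n :
  x * s i n * (y * s l m - z * s n m * (x * s i n) * (w * s l i)) =
  x * (y - z * x * w) * (s i m * s l n).
Proof.
have -> : z * s n m * (x * s i n) * (w * s l i) = z * x * w * s l m.
  rewrite mul_s sC s_chain mul_s; congr (_ * _).
  by rewrite sC s_chain.
rewrite -mulrBl mul_s; congr (_ * _).
by rewrite -(s_chain i m n) -(mulrA (s i m)) (sC m n) s_chain.
Qed.

Lemma ber_even_even i j m n :
  ber_even i m * ber_even j n = (ber_even n i)^-1 *
    (ber_even j m - ber_odd n m * (ber_even n i)^-1 * ber_odd j i).
Proof.
rewrite ber_evenV !ber_evenE !ber_oddE factor_s mul_s; congr (_ * _).
exact: odd_identity_even.
Qed.

Lemma ber_even_odd i l m n :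
  ber_even i m * ber_odd l n = (ber_even n i)^-1 *
    (ber_odd l m - ber_odd n m * (ber_even n i)^-1 * ber_even l i).
Proof.
rewrite ber_evenV !ber_evenE !ber_oddE factor_s mul_s; congr (_ * _).
exact: odd_identity_odd.
Qed.

End SuperColumns.

(** The representative chosen for the image of [s] may have a non-central numerator. Some [u] in [S]
    equates [u * fnum x] with [u * (s * fden x)], so the numerator commutes with everything after
    multiplication by [u], which is enough for equality of fractions. *)
Lemma loc_embed_central (R : nzRingType) (S : mulset R) (s : R) :
  (forall a, s * a = a * s) ->
  forall y : localization S, loc_embed S s * y = y * loc_embed S s.
Proof.
move=> sC y; rewrite /GRing.mul /= /loc_mul; apply: piL_eq; apply/asboolP.
set x := repr (loc_embed S s); set z := repr y.
have /asboolP [u hu] : frac_eq x (fracC S s) by apply: piL_repr.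
rewrite -[fden (fracC _ _)]/1 -[fnum (fracC _ _)]/s mulr1 => e.
exists u => //; rewrite /frac_mul !fnum_mk !fden_mk.
have hx := fdenP x; have hz := fdenP z.
have uxC a : u * (fnum x * a) = u * (a * fnum x).
  rewrite mulrA e [RHS]mulrA (mulsetC a hu) -(mulrA a) e.
  rewrite -(mulrA u) -(mulrA s) (mulsetC a hx) (mulrA s) sC -(mulrA a).
  by rewrite (mulrA u) (mulsetC a hu) -mulrA.
by rewrite (mulsetC _ hx) mulrA uxC -mulrA.
Qed.

Lemma ext_gen_anticomm (R : comNzRingType) n (i j : 'I_n) :
  ext_gen R i * ext_gen R j = - (ext_gen R j * ext_gen R i).
Proof.
by rewrite (ext_supercomm (@ext_gen_homog R n i) (@ext_gen_homog R n j)) mulN1r.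
Qed.

(** Anticommutation alone only gives that twice the square is zero; the vanishing of [ext_sign] on
    sets that meet works in every characteristic. *)
Lemma ext_gen_sq (R : comNzRingType) n (i : 'I_n) :
  ext_gen R i * ext_gen R i = 0.
Proof.
rewrite [LHS](ext_basisM R [set i] [set i]) /ext_sign disjoints1 set11.
by rewrite rmorph0 mul0r.
Qed.

Section Minors.
Variables (k : fieldType) (p q : nat).
Local Notation ev := (@x_ev k p q).
Local Notation od := (@x_od k p q).

Lemma x_ev_central i a : ev i * a = a * ev i.
Proof. by apply: loc_embed_central => b; apply: extC_central. Qed.

Lemma x_od_anticomm i j : od i * od j = - (od j * od i).
Proof. by rewrite /x_od -!rmorphM -rmorphN /odd_gen ext_gen_anticomm. Qed.

Lemma x_od_sq i : od i * od i = 0.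
Proof. by rewrite /x_od -rmorphM /odd_gen ext_gen_sq rmorph0. Qed.

Let entriesE := (row_mxEl, row_mxEr, block_mxEul, block_mxEur, block_mxEdl,
  block_mxEdr).
Let colE (j : 'I_(p + q)) i : col j (coord_mx k p q) i 0 = coord_mx k p q i j.
Proof. by rewrite mxE. Qed.

Lemma sminorE i mu :
  @sminor k p q i mu = ber_even ev od (lshift q i) (rshift p mu).
Proof. by rewrite /sminor BerE !entriesE !colE !entriesE !mxE. Qed.

(** [Ber_star] is [Ber] after exchanging both the rows and the columns, hence the reversed arguments
    here and in [fminor_starE]. *)
Lemma sminor_starE i mu :
  @sminor_star k p q i mu = ber_even ev od (rshift p mu) (lshift q i).
Proof. by rewrite /sminor_star Ber_starE !entriesE !colE !entriesE !mxE. Qed.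

Lemma fminorE lam mu :
  @fminor k p q lam mu = ber_odd ev od (rshift p lam) (rshift p mu).
Proof. by rewrite /fminor BerE !entriesE !colE !entriesE !mxE. Qed.

Lemma fminor_starE i j :
  @fminor_star k p q i j = ber_odd ev od (lshift q j) (lshift q i).
Proof. by rewrite /fminor_star Ber_starE !entriesE !colE !entriesE !mxE. Qed.

End Minors.

Theorem theorem5p1 (R : realType) (g : ground) (p q : nat)
    (hp : (0 < p)%N) (hq : (0 < q)%N) :
  let X := @sminor (ground_field R g) p q in
  let Xs := @sminor_star (ground_field R g) p q in
  let Xf := @fminor (ground_field R g) p q in
  let Xsf := @fminor_star (ground_field R g) p q in
  forall (i j k : 'I_p) (mu nu lam : 'I_q),
  [/\ X i mu * Xs i mu = 1,
      X i mu * X j nu = Ber (mx22 (X j mu) (Xf nu mu) (Xsf i j) (Xs i nu)),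
      X i mu * Xf lam nu = Ber (mx22 (Xf lam mu) (Xf nu mu) (Xs i lam) (Xs i nu))
    & Xs i mu * Xsf j k =
        Ber_star (mx22 (X j mu) (X k mu) (Xsf i j) (Xsf i k))].
Proof.
move=> X Xs Xf Xsf i j k mu nu lam; rewrite /X /Xs /Xf /Xsf.
have evU := @x_ev_unit (ground_field R g) p q.
have evC := @x_ev_central (ground_field R g) p q.
have odC := @x_od_anticomm (ground_field R g) p q.
have odS := @x_od_sq (ground_field R g) p q.
rewrite !Ber_mx22 Ber_star_mx22 !sminorE !sminor_starE !fminorE !fminor_starE.
split; [exact: ber_evenM | exact: ber_even_even | exact: ber_even_odd |].
(* Here the columns [i], [l], [m], [n] of [ber_even_odd] are those of [mu], [k], [i], [j]. *)
exact: ber_even_odd.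
Qed.
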